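(* Consider the inexact Rayleigh quotient iteration with MINRES for a Hermitian matrix $A$, as described in the context. Asymptotically we have $$\|w_{k+1}\|\ge\frac{(1-\xi_k)|\lambda_2-\lambda|}{4\beta\|r_k\|^2},$$ $$\|r_{k+1}\|\le\sqrt{\frac{1+\xi_k}{1-\xi_k}}\;\frac{4\beta}{|\lambda_2-\lambda|}\,\|r_k\|^2.$$ Thus, the inexact Rayleigh quotient iteration with MINRES converges quadratically at least once $\xi_k$ is not near one.
   Context: $A\in\mathbb{C}^{n\times n}$ is Hermitian with eigenvalues $\lambda=\lambda_1,\lambda_2,\ldots,\lambda_n$ and corresponding unit length eigenvectors $x=x_1,x_2,\ldots,x_n$; $(\lambda,x)$ is the desired eigenpair. $\lambda_{\min},\lambda_{\max}$ are the smallest and largest eigenvalues of $A$, $\|\cdot\|$ is the Euclidean norm, and $$\beta=\frac{\lambda_{\max}-\lambda_{\min}}{|\lambda_2-\lambda|}.$$ Inexact Rayleigh quotient iteration with MINRES: at outer iteration $k$, given a unit length vector $u_k$ approximating $x$, put $\theta_k=u_k^*Au_k$ and apply $m>1$ steps of (unpreconditioned) MINRES with zero initial guess to $(A-\theta_kI)w=u_k$; that is, $w_{k+1}$ minimizes $\|(A-\theta_kI)w-u_k\|$ over $w$ in the Krylov subspace $\mathcal{K}_m(A,u_k)=\mathrm{span}\{u_k,Au_k,\ldots,A^{m-1}u_k\}$. The inner tolerance is the relative residual norm $\xi_k=\|(A-\theta_kI)w_{k+1}-u_k\|$, which for MINRES always satisfies $\xi_k\le\|u_k\|=1$. The next iterate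 is $u_{k+1}=w_{k+1}/\|w_{k+1}\|$. The outer residual is $r_k=(A-\theta_kI)u_k$. Standing assumption: $u_k$ is a reasonably good approximation to $x$, and the eigenvalues are ordered so that $|\lambda-\theta_k|<|\lambda_2-\theta_k|\le\cdots\le|\lambda_n-\theta_k|$, with $|\lambda-\theta_k|<\tfrac12|\lambda-\lambda_2|$.
   Formalization: ''Asymptotically'' is read as: for every bound below 1 on ξ_k, the inequalities hold once the angle between u_k and x is small enough, depending on that bound; without keeping ξ_k away from 1 they fail, e.g. A=diag(0,1,-1), λ=0, u_k=(cos f, sin f/√2, sin f/√2), m=2. *)

(* Defs.v *)
From HB Require Import structures.
From mathcomp Require Import all_boot all_order all_algebra.
From mathcomp Require Import all_classical all_reals all_analysis.
From mathcomp Require Import complex.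

Set Implicit Arguments.
Unset Strict Implicit.
Unset Printing Implicit Defensive.

Import Order.TTheory GRing.Theory Num.Theory.
Import numFieldNormedType.Exports.

Local Open Scope ring_scope.
Local Open Scope complex_scope.
Local Open Scope sesquilinear_scope.
Local Open Scope classical_set_scope.

Section IRQI.
Variables (R : realType) (n : nat).
Local Notation C := R[i].
Implicit Types (A X : 'M[C]_n) (x u v w : 'cV[C]_n) (m : nat) (lam : 'I_n -> R).

(* MathComp-Analysis equips matrices with the sup norm, so the Euclidean norm
   is written out. *)
Definition enorm v : R := Num.sqrt (\sum_i Normc.normc (v i 0) ^+ 2).

(* [u^* A u] is real when [A] is Hermitian, the only case in which [rayleigh]
   is used; [Re] only casts it to [R]. *)
Definition rayleigh A u : R := complex.Re ((u^t* *m A *m u) 0 0).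

Definition shifted A u : 'M[C]_n := A - ((rayleigh A u)%:C)%:M.

Definition residual A u : 'cV[C]_n := shifted A u *m u.

Definition krylov m A u v : Prop :=
  exists c : 'I_m -> C, v = \sum_(i < m) c i *: iter i (mulmx A) u.

Definition minres_iterate m A u w : Prop :=
  krylov m A u w /\
  forall v, krylov m A u v ->
    enorm (shifted A u *m w - u) <= enorm (shifted A u *m v - u).

Definition inner_residual A u w : R := enorm (shifted A u *m w - u).

Definition normalized w : 'cV[C]_n := ((enorm w)^-1)%:C *: w.

(* Sine of the acute angle between the lines spanned by the unit vectors
   [x] and [u]; it does not depend on their phases. *)
Definition sin_angle x u : R :=
  Num.sqrt (1 - Normc.normc ((x^t* *m u) 0 0) ^+ 2).

(* The columns of [X] form an orthonormal basis of eigenvectors, so [lam]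
   lists all the eigenvalues with multiplicity. *)
Definition eigensystem A lam X : Prop :=
  X \is unitarymx /\ forall i, A *m col i X = (lam i)%:C *: col i X.

(* An inexact Rayleigh quotient iteration: [m k] inner MINRES steps at outer
   step [k], with every relative residual norm at most [xibar]. *)
Definition irqi_minres A (xibar : R) (m : nat -> nat) (u w : nat -> 'cV[C]_n)
    : Prop :=
  enorm (u 0%N) = 1 /\
  forall k, [/\ (1 < m k)%N, minres_iterate (m k) A (u k) (w k),
                inner_residual A (u k) (w k) <= xibar &
                u k.+1 = normalized (w k)].

End IRQI.

Section Eigenvalues.
Variables (R : realType) (n : nat).
Implicit Types (lam : 'I_n.+2 -> R).

(* The eigenvalues [lambda_1], [lambda_2], ... are [lam 0], [lam 1], ...;
   [lambda_1] is the desired one. *)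
Definition lam1 lam : R := lam ord0.
Definition lam2 lam : R := lam (lift ord0 ord0).

Definition lam_max lam : R := \big[Num.max/lam ord0]_i lam i.
Definition lam_min lam : R := \big[Num.min/lam ord0]_i lam i.

Definition beta lam : R := (lam_max lam - lam_min lam) / `|lam2 lam - lam1 lam|.

Definition ordered_around lam (theta : R) : Prop :=
  [/\ `|lam1 lam - theta| < `|lam2 lam - theta|,
      forall i j : 'I_n.+2, (0 < i)%N -> (i <= j)%N ->
        `|lam i - theta| <= `|lam j - theta| &
      `|lam1 lam - theta| < 2^-1 * `|lam1 lam - lam2 lam|].

(* The numbering [lambda_2, ..., lambda_n] depends on the shift [theta_k], hence
   on the current iterate [u], whereas [lambda_1 = lambda] and [x_1 = x] are
   fixed. *)
Definition standing (A : 'M[R[i]]_n.+2) (lambda : R) (x u : 'cV[R[i]]_n.+2)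
    lam (X : 'M[R[i]]_n.+2) : Prop :=
  [/\ eigensystem A lam X, lam1 lam = lambda, col ord0 X = x &
      ordered_around lam (rayleigh A u)].

End Eigenvalues.

Definition converges_quadratically_to_0 (R : realType) (e : nat -> R) : Prop :=
  (e @ \oo --> (0 : R)) /\ exists K : R, forall k, e k.+1 <= K * e k ^+ 2.

(* Main.v *)
Require Import Defs.
From HB Require Import structures.
From mathcomp Require Import all_boot all_order all_algebra.
From mathcomp Require Import all_classical all_reals all_analysis.
From mathcomp Require Import complex.
From mathcomp Require Import ring lra.

Set Implicit Arguments.
Unset Strict Implicit.
Unset Printing Implicit Defensive.

Import Order.TTheory GRing.Theory Num.Theory.
Import numFieldNormedType.Exports.

Local Open Scope ring_scope.
Local Open Scope complex_scope.
Local Open Scope sesquilinear_scope.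

(** Everything is read in the eigenbasis. Write [theta] for the Rayleigh quotient
    of the unit vector [u], [B = A - theta], [r = |B u|], and let [w] be the MINRES
    iterate and [B w = u + d] with [|d| = xi]. Let [c] be the modulus of the
    component of [u] along [x], so [c] tends to 1 with the angle.

    Growth. The component of [B w] along [x] has modulus
    [|lambda - theta| * |w_x|], and it is at least [c - xi] because the residual [d]
    has norm [xi]. Hence [c - xi <= |lambda - theta| * |w|] ([iterate_growth]). As
    [xi <= xibar < 1], the left side is comparable to [1 - xi] once the angle
    is small relative to [1 - xibar]. The Rayleigh quotient is accurate to
    second order: the weighted mean of the [lam i - theta] is zero, whence
    [c ^ 2 * |lambda - theta| * G <= r ^ 2] when the other eigenvalues lie at
    distance at least [G] from [theta] ([temple_bound]). Together they make [|w|]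
    at least of order [(1 - xi) * G / r ^ 2].

    Residual. The Rayleigh quotient minimizes the residual over all shifts, so the
    new outer residual is at most [|B w| / |w|] ([residual_normalized]).
    Minimality of MINRES along the line spanned by [w] gives
    [|B w| ^ 2 = 1 - xi ^ 2] ([minres_energy]), and dividing by the bound on [|w|]
    yields the factor [sqrt ((1 + xi) / (1 - xi))].

    Convergence. The components of [w] orthogonal to [x] are those of [B w]
    divided by numbers of modulus at least [G], so the new sine is at most
    [1 / (G * |w|)] ([sin_angle_normalized]); since [|lambda - theta|] is also at
    most a constant times the squared sine ([rayleigh_error]), the sine contracts
    quadratically. A small enough initial angle therefore stays small. This part uses
    the separation of [lambda] from the rest of the spectrum only, not the numbering of
    the eigenvalues at each step. *)

(** * Moduli and Euclidean norms *)

Section Modulus.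
Variable R : realType.
Implicit Types z : R[i].
Local Notation normc := Normc.normc.

Lemma sqr_normcE z : normc z ^+ 2 = complex.Re z ^+ 2 + complex.Im z ^+ 2.
Proof. by case: z => a b /=; rewrite sqr_sqrtr// addr_ge0 ?sqr_ge0. Qed.

Lemma normc_ge0 z : 0 <= normc z.
Proof. by case: z => a b /=; rewrite sqrtr_ge0. Qed.

Lemma normc_real (a : R) : normc a%:C = `|a|.
Proof. by rewrite /= expr0n addr0 sqrtr_sqr. Qed.

Lemma conjC_mul_self z : Num.conj z * z = (normc z ^+ 2)%:C.
Proof. by rewrite mulrC -normCK /Num.norm/= rmorphXn. Qed.

End Modulus.

Section EuclideanNorm.
Variables (R : realType) (n : nat).
Local Notation C := R[i].
Local Notation normc := Normc.normc.
Implicit Types (v y u : 'cV[C]_n).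

Lemma enorm_ge0 v : 0 <= enorm v.
Proof. exact: sqrtr_ge0. Qed.

Lemma sqr_enorm v : enorm v ^+ 2 = \sum_i normc (v i 0) ^+ 2.
Proof. by rewrite sqr_sqrtr// sumr_ge0// => i _; rewrite sqr_ge0. Qed.

Lemma enorm_dot v : (v^t* *m v) 0 0 = (enorm v ^+ 2)%:C.
Proof.
rewrite sqr_enorm rmorph_sum mxE; apply: eq_bigr => i _.
by rewrite !mxE conjC_mul_self.
Qed.

Lemma enormZ (a : R) v : enorm (a%:C *: v) = `|a| * enorm v.
Proof.
apply/eqP; rewrite -(eqrXn2 (_ : 0 < 2)%N) ?mulr_ge0 ?enorm_ge0//.
rewrite exprMn !sqr_enorm mulr_sumr; apply/eqP/eq_bigr => i _.
by rewrite mxE Normc.normcM normc_real exprMn.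
Qed.

Lemma enorm_normalized (w : 'cV[C]_n) : 0 < enorm w -> enorm (normalized w) = 1.
Proof.
by move=> w0; rewrite /normalized enormZ ger0_norm ?invr_ge0 ?enorm_ge0// mulVf ?gt_eqF.
Qed.

(** The coefficient [b] is twice a real inner product; minimality in [t] will
    determine it, so its formula stays hidden. *)
Lemma sqr_enorm_line y u : exists b : R, forall t : R,
  enorm (t%:C *: y - u) ^+ 2 = t ^+ 2 * enorm y ^+ 2 - t * b + enorm u ^+ 2.
Proof.
exists (\sum_i 2 * (complex.Re (y i 0) * complex.Re (u i 0)
                  + complex.Im (y i 0) * complex.Im (u i 0))) => t.
rewrite !sqr_enorm !mulr_sumr -sumrB -big_split/=; apply: eq_bigr => i _.
rewrite !mxE !sqr_normcE.
by case: (y i 0) (u i 0) => [a b] [c d] /=; ring.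
Qed.

End EuclideanNorm.

(** * MINRES is optimal along the line through its iterate *)

Lemma quadratic_min_at_one (R : realFieldType) (a b : R) : 0 <= a ->
  (forall t, a - b <= t ^+ 2 * a - t * b) -> b = 2 * a.
Proof.
move=> a0 h; apply/eqP; rewrite eq_sym -subr_eq0 -sqrf_eq0 eq_le sqr_ge0 andbT.
have a1 : 0 < a + 1 by rewrite ltr_wpDl.
(* A shortened Newton step from 1 refutes minimality; dividing by [a + 1] rather
   than by [a] covers [a = 0]. *)
set e := (b - 2 * a) / (2 * (a + 1)).
have be : b = 2 * a + e * (2 * (a + 1)) by rewrite divfK ?mulf_neq0 ?gt_eqF//; ring.
clearbody e; have := h (1 + e); rewrite be => he.
have : e ^+ 2 * (a + 2) <= 0 by nra.
have -> : 2 * a - (2 * a + e * (2 * (a + 1))) = - (e * (2 * (a + 1))) by ring.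
rewrite sqrrN exprMn pmulr_lle0 ?ltr_wpDl// => e0.
by apply: mulr_le0_ge0; rewrite ?sqr_ge0.
Qed.

Section Minres.
Variables (R : realType) (n : nat).
Local Notation C := R[i].
Implicit Types (A : 'M[C]_n) (u w : 'cV[C]_n).

Lemma krylovZ m A u w a : krylov m A u w -> krylov m A u (a *: w).
Proof.
move=> [c ->]; exists (fun i => a * c i).
by rewrite scaler_sumr; apply: eq_bigr => i _; rewrite scalerA.
Qed.

(** The residual of the best approximation [B w] of [u] is orthogonal to [B w],
    which is Pythagoras for [u]. *)
Lemma minres_energy m A u w : enorm u = 1 -> minres_iterate m A u w ->
  enorm (shifted A u *m w) ^+ 2 = 1 - inner_residual A u w ^+ 2.
Proof.
move=> u1 [Kw opt]; set y := _ *m w.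
have [b yb] := sqr_enorm_line y u.
have xiE : inner_residual A u w ^+ 2 = enorm y ^+ 2 - b + 1.
  by have := yb 1; rewrite scale1r u1 /inner_residual -/y => ->; ring.
suff bE : b = 2 * enorm y ^+ 2 by rewrite xiE bE; ring.
apply: quadratic_min_at_one => [|t]; first exact: sqr_ge0.
have := opt _ (krylovZ t%:C Kw).
rewrite -scalemxAr -/y -/(inner_residual A u w).
rewrite -(ler_pXn2r (_ : 0 < 2)%N) ?nnegrE ?enorm_ge0// xiE yb u1 expr1n.
by rewrite lerD2r.
Qed.

End Minres.

(** * Coordinates in an orthonormal eigenbasis *)

Lemma sqr_sin_angle_small (R : realType) (n : nat) (x u : 'cV[R[i]]_n)
    (delta c : R) : delta <= 1 -> delta <= c -> sin_angle x u < delta ->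
  sin_angle x u ^+ 2 <= c.
Proof.
move=> delta1 deltac /ltW sd; have s0 : 0 <= sin_angle x u := sqrtr_ge0 _.
rewrite expr2; apply: le_trans (le_trans sd deltac).
by rewrite ler_piMr// (le_trans sd).
Qed.

Section EigenCoordinates.
Variables (R : realType) (n : nat).
Local Notation C := R[i].
Local Notation normc := Normc.normc.
Variables (A X : 'M[C]_n) (lam : 'I_n -> R).
Hypothesis eigX : eigensystem A lam X.
Implicit Types (u v w : 'cV[C]_n) (i : 'I_n).

Definition modulus i v : R := normc ((X^t* *m v) i 0).

Lemma modulus_ge0 i v : 0 <= modulus i v.
Proof. exact: normc_ge0. Qed.

Lemma modulusE i v : modulus i v = normc (((col i X)^t* *m v) 0 0).
Proof. by congr normc; rewrite !mxE; apply: eq_bigr => j _; rewrite !mxE. Qed.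

Let XXt : X *m X^t* = 1%:M.
Proof. by case: eigX => /unitarymxP. Qed.

Lemma trmx_conj_mul m1 m2 m3 (M : 'M[C]_(m1, m2)) (N : 'M[C]_(m2, m3)) :
  (M *m N)^t* = N^t* *m M^t*.
Proof. by rewrite trmx_mul map_mxM. Qed.

Lemma trmx_conjK m1 m2 (M : 'M[C]_(m1, m2)) : (M^t*)^t* = M.
Proof. by apply/matrixP => i j; rewrite !mxE conjCK. Qed.

Lemma parseval v : enorm v ^+ 2 = \sum_i modulus i v ^+ 2.
Proof.
rewrite -[RHS]sqr_enorm; apply: complexI; rewrite -!enorm_dot.
by rewrite trmx_conj_mul trmx_conjK mulmxA -[v^t* *m X *m _]mulmxA XXt mulmx1.
Qed.

Lemma modulus_le i v : modulus i v <= enorm v.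
Proof.
rewrite -(ler_pXn2r (_ : 0 < 2)%N) ?nnegrE ?modulus_ge0 ?enorm_ge0//.
rewrite parseval (bigD1 i)//= lerDl sumr_ge0// => j _; exact: sqr_ge0.
Qed.

Lemma eigencoord_mul i v : (X^t* *m (A *m v)) i 0 = (lam i)%:C * (X^t* *m v) i 0.
Proof.
have AX : A *m X = X *m diag_mx (\row_j (lam j)%:C).
  apply/matrixP => k j; rewrite mul_mx_diag !mxE.
  have [_ /(_ j)/matrixP/(_ k 0)] := eigX.
  rewrite !mxE mulrC => <-; apply: eq_bigr => l _; by rewrite !mxE.
have -> : A *m v = X *m (diag_mx (\row_j (lam j)%:C) *m (X^t* *m v)).
  by rewrite mulmxA -AX mulmxA -[A *m X *m _]mulmxA XXt mulmx1.
by rewrite !mulmxA (mulmx1C XXt) mul1mx -mulmxA mul_diag_mx !mxE.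
Qed.

Lemma modulus_shifted i u w :
  modulus i (shifted A u *m w) = `|lam i - rayleigh A u| * modulus i w.
Proof.
rewrite /modulus /shifted mulmxBl mulmxBr mxE [X in _ + X]mxE eigencoord_mul.
rewrite mul_scalar_mx -scalemxAr [X in _ - X]mxE -mulrBl Normc.normcM.
by rewrite -rmorphB normc_real.
Qed.

Lemma modulusZ i (a : R) w : modulus i (a%:C *: w) = `|a| * modulus i w.
Proof. by rewrite /modulus -scalemxAr mxE Normc.normcM normc_real. Qed.

Lemma modulus_subl i v w : modulus i v <= modulus i w + enorm (w - v).
Proof.
have -> : modulus i v = normc ((X^t* *m w) i 0 + - (X^t* *m (w - v)) i 0).
  by congr normc; rewrite mulmxBr !mxE opprB addrCA subrr addr0.
apply: le_trans (le_normcD _ _) _; rewrite normcN lerD2l.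
exact: modulus_le.
Qed.

Lemma rayleigh_modulus u : rayleigh A u = \sum_i lam i * modulus i u ^+ 2.
Proof.
rewrite /rayleigh.
suff -> : (u^t* *m A *m u) 0 0 = (\sum_i lam i * modulus i u ^+ 2)%:C by [].
have -> : u^t* *m A *m u = (X^t* *m u)^t* *m (X^t* *m (A *m u)).
  by rewrite trmx_conj_mul trmx_conjK mulmxA -[u^t* *m X *m _]mulmxA XXt mulmx1 mulmxA.
rewrite mxE rmorph_sum; apply: eq_bigr => i _.
rewrite eigencoord_mul mxE [_^T _ _]mxE mulrCA conjC_mul_self.
by rewrite [RHS]rmorphM.
Qed.

Lemma sqr_residual u :
  enorm (residual A u) ^+ 2 = \sum_i (lam i - rayleigh A u) ^+ 2 * modulus i u ^+ 2.
Proof.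
rewrite parseval; apply: eq_bigr => i _.
by rewrite modulus_shifted exprMn real_normK ?num_real.
Qed.

Section UnitVector.
Variable u : 'cV[C]_n.
Hypothesis u1 : enorm u = 1.

Lemma sum_sqr_modulus : \sum_i modulus i u ^+ 2 = 1.
Proof. by rewrite -parseval u1 expr1n. Qed.

Lemma sum_dev_modulus t :
  \sum_i (lam i - t) * modulus i u ^+ 2 = rayleigh A u - t.
Proof.
under eq_bigr do rewrite mulrBl.
by rewrite sumrB -rayleigh_modulus -mulr_sumr sum_sqr_modulus mulr1.
Qed.

(** A mean minimizes the mean squared deviation: the Rayleigh quotient is the mean of the
    eigenvalues with the weights [modulus i u ^+ 2]. *)
Lemma residual_min t :
  enorm (residual A u) ^+ 2 <= \sum_i (lam i - t) ^+ 2 * modulus i u ^+ 2.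
Proof.
set th := rayleigh A u.
have -> : \sum_i (lam i - t) ^+ 2 * modulus i u ^+ 2
   = \sum_i (lam i - th) ^+ 2 * modulus i u ^+ 2 + (th - t) ^+ 2.
  have -> : (th - t) ^+ 2 = 2 * (th - t) * \sum_i (lam i - th) * modulus i u ^+ 2
        + (th - t) ^+ 2 * \sum_i modulus i u ^+ 2.
    by rewrite sum_dev_modulus sum_sqr_modulus; ring.
  rewrite !mulr_sumr -!big_split/=; apply: eq_bigr => i _; ring.
by rewrite sqr_residual lerDl sqr_ge0.
Qed.

(** The deviations [lam i - theta] have weighted mean zero, so the deviation at
    [i0] is balanced by the others; these have modulus at least [G], so each is
    at most its square divided by [G]. *)
Lemma temple_bound i0 (G : R) : 0 <= G ->
  (forall i, i != i0 -> G <= `|lam i - rayleigh A u|) ->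
  modulus i0 u ^+ 2 * `|lam i0 - rayleigh A u| * G <= enorm (residual A u) ^+ 2.
Proof.
set th := rayleigh A u => G0 hG.
have : \sum_i (lam i - th) * modulus i u ^+ 2 = 0.
  by rewrite sum_dev_modulus subrr.
rewrite (bigD1 i0)//= => /eqP; rewrite addr_eq0 => /eqP E.
have -> : modulus i0 u ^+ 2 * `|lam i0 - th| =
          `|\sum_(i | i != i0) (lam i - th) * modulus i u ^+ 2|.
  by rewrite -[RHS]normrN -E normrM mulrC [X in _ = _ * X]ger0_norm ?sqr_ge0.
apply: (@le_trans _ _ (\sum_(i | i != i0) (lam i - th) ^+ 2 * modulus i u ^+ 2)).
  apply: le_trans (ler_wpM2r G0 (ler_norm_sum _ _ _)) _.
  rewrite mulr_suml; apply: ler_sum => i ii0.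
  rewrite normrM [`|_ ^+ 2|]ger0_norm ?sqr_ge0// -(real_normK (num_real (lam i - _)))//.
  by rewrite mulrAC ler_wpM2r ?sqr_ge0// expr2 ler_wpM2l// hG.
by rewrite sqr_residual [leRHS](bigD1 i0)//= lerDr mulr_ge0 ?sqr_ge0.
Qed.

Lemma sqr_sin_angle i0 :
  sin_angle (col i0 X) u ^+ 2 = \sum_(i | i != i0) modulus i u ^+ 2.
Proof.
have E : 1 - modulus i0 u ^+ 2 = \sum_(i | i != i0) modulus i u ^+ 2.
  by rewrite -sum_sqr_modulus (bigD1 i0)//= addrAC subrr add0r.
rewrite /sin_angle -modulusE E sqr_sqrtr// sumr_ge0// => i _; exact: sqr_ge0.
Qed.

Lemma sqr_modulus_cos i0 : modulus i0 u ^+ 2 = 1 - sin_angle (col i0 X) u ^+ 2.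
Proof.
by rewrite sqr_sin_angle -sum_sqr_modulus [in RHS](bigD1 i0)//= addrK.
Qed.

(** The Rayleigh quotient is accurate to second order in the angle. The sum of the
    spectral distances serves as a crude bound for the largest one. *)
Lemma rayleigh_error i0 :
  `|lam i0 - rayleigh A u|
    <= (\sum_i `|lam i - lam i0|) * sin_angle (col i0 X) u ^+ 2.
Proof.
rewrite distrC -sum_dev_modulus (bigD1 i0)//= subrr mul0r add0r.
apply: le_trans (ler_norm_sum _ _ _) _.
rewrite sqr_sin_angle mulr_sumr; apply: ler_sum => i _.
rewrite normrM [`|_ ^+ 2|]ger0_norm ?sqr_ge0// ler_wpM2r ?sqr_ge0//.
by rewrite (bigD1 i)//= lerDl sumr_ge0.
Qed.

Lemma residual_le_sin i0 :
  enorm (residual A u) <= (\sum_i `|lam i - lam i0|) * sin_angle (col i0 X) u.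
Proof.
rewrite -(ler_pXn2r (_ : 0 < 2)%N) ?nnegrE ?enorm_ge0 ?mulr_ge0 ?sumr_ge0 ?sqrtr_ge0//.
apply: le_trans (residual_min (lam i0)) _.
rewrite (bigD1 i0)//= subrr expr0n/= mul0r add0r exprMn sqr_sin_angle mulr_sumr.
apply: ler_sum => i _; rewrite ler_wpM2r ?sqr_ge0// -(real_normK (num_real (lam i - _)))//.
rewrite ler_pXn2r ?nnegrE ?sumr_ge0//.
by rewrite (bigD1 i)//= lerDl sumr_ge0.
Qed.

End UnitVector.

(** In the direction of [col i0 X], [shifted A u] acts as multiplication by the
    small number [lam i0 - theta], whereas the image of [w] differs from [u] by
    [xi] only: this forces [w] to be large. *)
Lemma iterate_growth i0 u w :
  modulus i0 u - inner_residual A u w <= `|lam i0 - rayleigh A u| * enorm w.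
Proof.
rewrite lerBlDr; apply: le_trans (modulus_subl i0 u (shifted A u *m w)) _.
by rewrite lerD2r modulus_shifted ler_wpM2l// modulus_le.
Qed.

(** The old shift is a competitor for the new Rayleigh quotient in
    [residual_min]. *)
Lemma residual_normalized u w : 0 < enorm w ->
  enorm (residual A (normalized w)) * enorm w <= enorm (shifted A u *m w).
Proof.
move=> w0; rewrite -ler_pdivlMr// -(ler_pXn2r (_ : 0 < 2)%N) ?nnegrE ?divr_ge0 ?enorm_ge0//.
apply: le_trans (residual_min (enorm_normalized w0) (rayleigh A u)) _.
rewrite exprMn parseval mulr_suml ler_sum// => i _.
rewrite modulusZ modulus_shifted !exprMn !real_normK ?num_real//.
by rewrite mulrCA mulrC.
Qed.

Lemma sin_angle_normalized i0 u w (G : R) : 0 <= G -> 0 < enorm w ->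
  (forall i, i != i0 -> G <= `|lam i - rayleigh A u|) ->
  sin_angle (col i0 X) (normalized w) * enorm w * G <= enorm (shifted A u *m w).
Proof.
move=> G0 w0 hG.
rewrite -(ler_pXn2r (_ : 0 < 2)%N) ?nnegrE ?mulr_ge0 ?sqrtr_ge0 ?enorm_ge0//.
rewrite !exprMn sqr_sin_angle ?enorm_normalized// !mulr_suml [leRHS]parseval.
rewrite [leRHS](bigD1 i0)//= ler_wpDl ?sqr_ge0// ler_sum// => i ii0.
rewrite modulusZ modulus_shifted ger0_norm ?invr_ge0 ?enorm_ge0//.
rewrite -!exprMn [_^-1 * _]mulrC divfK ?gt_eqF//.
rewrite mulrC ler_pXn2r ?nnegrE ?mulr_ge0 ?modulus_ge0//.
by rewrite ler_wpM2r ?modulus_ge0// hG.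
Qed.

(** * One outer step from a small angle *)

Section OneStep.
Variables (i0 : 'I_n) (m : nat) (u w : 'cV[C]_n) (xibar G : R).
Local Notation theta := (rayleigh A u).
Local Notation xi := (inner_residual A u w).
Local Notation r := (enorm (residual A u)).
Local Notation D := (\sum_i `|lam i - lam i0|).
Hypotheses (u1 : enorm u = 1) (mw : minres_iterate m A u w).
Hypotheses (xi_le : xi <= xibar) (xibar1 : xibar < 1).
Hypothesis small_angle : sin_angle (col i0 X) u ^+ 2 <= (1 - xibar) / 6.
Hypotheses (G0 : 0 < G) (hG : forall i, i != i0 -> G <= `|lam i - theta|).

Let xi0 : 0 <= xi. Proof. exact: enorm_ge0. Qed.

(** The angle is measured against [1 - xibar], so that [1 - c], hence also the
    loss from [1 - xi] to [c - xi], is at most a sixth of [1 - xi]. *)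
Lemma growth_bounds : 25 / 36 <= modulus i0 u ^+ 2 /\
  5 / 6 * (1 - xi) <= `|lam i0 - theta| * enorm w.
Proof.
have c2 := sqr_modulus_cos u1 i0; have c0 := modulus_ge0 i0 u.
have c1 : modulus i0 u <= 1 by rewrite -u1 modulus_le.
have cc : modulus i0 u ^+ 2 <= modulus i0 u by rewrite expr2 ler_piMr.
have ? : 5 / 6 <= modulus i0 u by move: xi0 xi_le small_angle; lra.
split; first by nra.
by apply: le_trans (iterate_growth i0 u w); move: xi0 xi_le small_angle; lra.
Qed.

Lemma iterate_gt0 : 0 < enorm w.
Proof.
have [_ h] := growth_bounds; rewrite lt_neqAle enorm_ge0 andbT eq_sym.
by apply/eqP => w0; move: h; rewrite w0 mulr0; move: xi_le xibar1; lra.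
Qed.

Lemma shifted_le1 : enorm (shifted A u *m w) <= 1.
Proof.
rewrite -(ler_pXn2r (_ : 0 < 2)%N) ?nnegrE ?enorm_ge0//.
by rewrite expr1n (minres_energy u1 mw) gerBl sqr_ge0.
Qed.

Lemma rayleigh_error_residual : 25 / 36 * (`|lam i0 - theta| * G) <= r ^+ 2.
Proof.
have [c2 _] := growth_bounds; apply: le_trans (temple_bound u1 (ltW G0) hG).
by rewrite -[leRHS]mulrA ler_wpM2r// mulr_ge0// ltW.
Qed.

(** Since [25/36 * 5/6 > 1/2], the constants lost to the angle are absorbed by
    the factor 2. *)
Lemma iterate_large : (1 - xi) * G <= 2 * r ^+ 2 * enorm w.
Proof.
have [c2 h] := growth_bounds; have w0 := iterate_gt0.
have tG := rayleigh_error_residual.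
have : 0 <= (1 - xi) * G by rewrite mulr_ge0 ?ltW// subr_gt0 (le_lt_trans xi_le).
have := ler_wpM2r (ltW w0) tG; have := ler_wpM2r (ltW G0) h; lra.
Qed.

(** The new sine times [|lambda - theta| * enorm w] is at least a multiple of the
    sine by [growth_bounds] and at most [|lambda - theta| / G] by
    [sin_angle_normalized]. *)
Lemma sin_angle_step :
  sin_angle (col i0 X) (normalized w) * (5 / 6 * (1 - xibar) * G)
    <= D * sin_angle (col i0 X) u ^+ 2.
Proof.
have [_ h] := growth_bounds; have w0 := iterate_gt0.
apply: le_trans (rayleigh_error u1 i0).
have s'1 := le_trans (sin_angle_normalized (ltW G0) w0 hG) shifted_le1.
set s' := sin_angle _ _ in s'1 *; set t := `|lam i0 - theta| in h *.
have s'G : 0 <= s' * G by rewrite mulr_ge0 ?sqrtr_ge0 ?ltW.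
have t0 : 0 <= t := normr_ge0 _.
have := ler_wpM2l t0 s'1; have := ler_wpM2l s'G h.
have := ler_wpM2l s'G xi_le; lra.
Qed.

Lemma residual_step :
  enorm (residual A (normalized w)) * (5 / 6 * (1 - xibar) * (25 / 36 * G))
    <= r ^+ 2.
Proof.
have [c2 h] := growth_bounds; have w0 := iterate_gt0.
have r'1 := le_trans (residual_normalized u w0) shifted_le1.
set r' := enorm (residual A (normalized w)) in r'1 *.
have r'0 : 0 <= r' by exact: enorm_ge0.
apply: le_trans rayleigh_error_residual; set t := `|lam i0 - theta| in h *.
have t0 : 0 <= t := normr_ge0 _.
have : r' * (5 / 6 * (1 - xibar)) <= t.
  have := ler_wpM2l t0 r'1; have := ler_wpM2l r'0 h.
  have := ler_wpM2l r'0 xi_le; lra.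
by move=> /(ler_wpM2r (ltW G0)); lra.
Qed.

End OneStep.

(** * Iteration from a small initial angle *)

Section Iteration.
Variables (i0 : 'I_n) (xibar g delta : R).
Local Notation D := (\sum_i `|lam i - lam i0|).
Local Notation kappa := (5 / 6 * (1 - xibar) * (g / 2)).
Hypotheses (xibar1 : xibar < 1) (g0 : 0 < g).
Hypothesis hg : forall i, i != i0 -> g <= `|lam i - lam i0|.
Hypotheses (delta1 : delta <= 1) (delta_xi : delta <= (1 - xibar) / 6).
Hypotheses (delta_g : D * delta <= g / 2) (delta_k : D * delta <= kappa / 2).

Let D0 : 0 <= D. Proof. exact: sumr_ge0. Qed.

(** The Rayleigh quotient stays within [g / 2] of [lam i0], so the separation of the
    spectrum survives the shift up to a factor 2. *)
Lemma shifted_gap u : enorm u = 1 -> sin_angle (col i0 X) u < delta ->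
  forall i, i != i0 -> g / 2 <= `|lam i - rayleigh A u|.
Proof.
move=> u1 sd i ii0; have := rayleigh_error u1 i0.
have s2 := sqr_sin_angle_small delta1 (lexx _) sd.
have := ler_wpM2l D0 s2; have := hg ii0.
have := ler_distD (rayleigh A u) (lam i) (lam i0).
rewrite [`|rayleigh A u - _|]distrC; have := delta_g; lra.
Qed.

Variables (m : nat -> nat) (u w : nat -> 'cV[C]_n).
Hypothesis irqi : irqi_minres A xibar m u w.
Hypothesis start : sin_angle (col i0 X) (u 0%N) < delta.
Local Notation s k := (sin_angle (col i0 X) (u k)).

Lemma irqi_step k : enorm (u k) = 1 -> s k < delta ->
  [/\ enorm (u k.+1) = 1, s k.+1 * kappa <= D * s k ^+ 2 &
      enorm (residual A (u k.+1)) * (5 / 6 * (1 - xibar) * (25 / 36 * (g / 2)))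
        <= enorm (residual A (u k)) ^+ 2].
Proof.
move=> u1 sd; have [_ /(_ k)[_ mw xi_le ->]] := irqi.
have small := sqr_sin_angle_small delta1 delta_xi sd.
have G0 : 0 < g / 2 by rewrite divr_gt0.
have gap := shifted_gap u1 sd.
split.
- exact/enorm_normalized/(iterate_gt0 u1 xi_le xibar1 small).
- exact: sin_angle_step u1 mw xi_le xibar1 small G0 gap.
- exact: residual_step u1 mw xi_le xibar1 small G0 gap.
Qed.

Let kappa0 : 0 < kappa.
Proof. by rewrite !mulr_gt0 ?invr_gt0// subr_gt0. Qed.

(** The smallness of [delta] turns the quadratic bound into a halving of the sine,
    which both keeps the iterates in the small cone and gives convergence. *)
Lemma irqi_invariant k :
  [/\ enorm (u k) = 1, s k < delta & s k <= geometric (s 0%N) 2^-1 k].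
Proof.
elim: k => [|k [u1 sd sk]].
  by split; [have [] := irqi | exact: start | rewrite /geometric/= expr0 mulr1].
have [u1' step _] := irqi_step u1 sd.
have s0 : 0 <= s k := sqrtr_ge0 _.
have half : s k.+1 <= s k / 2.
  rewrite -(ler_pM2r kappa0); apply: le_trans step _.
  rewrite expr2 mulrA; have := ler_wpM2l D0 (ltW sd) => Ds.
  by have := ler_wpM2r s0 (le_trans Ds delta_k); lra.
split => //; first by apply: le_lt_trans half _; lra.
apply: le_trans half _; rewrite /geometric/= exprSr mulrA.
by rewrite ler_pM2r ?invr_gt0.
Qed.

Lemma irqi_sin_cvg0 : ((fun k => s k) @ \oo --> (0 : R))%classic.
Proof.
apply: (@squeeze_cvgr _ _ _ _ (cst 0) (geometric (s 0%N) 2^-1)).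
- near=> k; have [_ _ ->] := irqi_invariant k.
  by rewrite sqrtr_ge0.
- exact: cvg_cst.
- by apply: cvg_geometric; rewrite gtr0_norm ?invf_lt1 ?ltr1n.
Unshelve. all: by end_near. Qed.

Lemma irqi_sin_quadratic : converges_quadratically_to_0 (fun k => s k).
Proof.
split; first exact: irqi_sin_cvg0.
exists (D / kappa) => k; have [u1 sd _] := irqi_invariant k.
have [_ step _] := irqi_step u1 sd.
by rewrite mulrAC ler_pdivlMr.
Qed.

Lemma irqi_residual_quadratic :
  converges_quadratically_to_0 (fun k => enorm (residual A (u k))).
Proof.
split.
  apply: (@squeeze_cvgr _ _ _ _ (cst 0) (fun k => D * s k)).
  - near=> k; have [u1 _ _] := irqi_invariant k.
    by rewrite enorm_ge0 residual_le_sin.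
  - exact: cvg_cst.
  - rewrite -[X in (_ --> X)%classic](mulr0 D); apply: cvgM; [exact: cvg_cst|exact: irqi_sin_cvg0].
exists (5 / 6 * (1 - xibar) * (25 / 36 * (g / 2)))^-1 => k.
have [u1 sd _] := irqi_invariant k.
have [_ _ step] := irqi_step u1 sd.
rewrite mulrC ler_pdivlMr// !mulr_gt0 ?invr_gt0// subr_gt0//.
Unshelve. all: by end_near. Qed.

End Iteration.

End EigenCoordinates.

(** * The ordering of the eigenvalues and the final estimates *)

Section Spectrum.
Variables (R : realType) (n : nat) (lam : 'I_n.+2 -> R).

Lemma gap_le_spread : `|lam2 lam - lam1 lam| <= lam_max lam - lam_min lam.
Proof.
have hi i : lam i <= lam_max lam by exact: le_bigmax.
have lo i : lam_min lam <= lam i by exact: bigmin_le.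
have := (hi ord0, hi (lift ord0 ord0), lo ord0, lo (lift ord0 ord0)).
move=> [[[h1 h2] l1] l2].
by rewrite ler_norml /lam1 /lam2; apply/andP; split; lra.
Qed.

Lemma beta_ge1 : 0 < `|lam2 lam - lam1 lam| -> 1 <= beta lam.
Proof. by move=> g0; rewrite /beta ler_pdivlMr// mul1r gap_le_spread. Qed.

Lemma ordered_around_gap theta : ordered_around lam theta ->
  [/\ forall i, i != ord0 -> `|lam2 lam - theta| <= `|lam i - theta|,
      `|lam2 lam - lam1 lam| < 2 * `|lam2 lam - theta| &
      0 < `|lam2 lam - lam1 lam|].
Proof.
move=> [_ mono]; rewrite [`|lam1 lam - lam2 lam|]distrC => h2.
split.
- move=> i i0; apply: mono => //.
  by rewrite lt0n.
- have := ler_distD theta (lam2 lam) (lam1 lam).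
  by rewrite [`|theta - _|]distrC; lra.
- by have := normr_ge0 (lam1 lam - theta); lra.
Qed.

(** The shift is strictly closer to the first eigenvalue than to any other; by the
    triangle inequality the difference of the distances separates the first one. *)
Lemma standing_separation (A X : 'M[R[i]]_n.+2) lambda x u :
  standing A lambda x u lam X ->
  exists2 g : R, 0 < g & forall i, i != ord0 -> g <= `|lam i - lam ord0|.
Proof.
move=> [_ _ _ ord]; have [far _ _] := ordered_around_gap ord.
case: ord => near1 _ _; set th := rayleigh A u in far near1.
exists (`|lam2 lam - th| - `|lam1 lam - th|); first by rewrite subr_gt0.
move=> i /far fi; have := ler_distD (lam ord0) (lam i) th.
by rewrite /lam1; lra.
Qed.

End Spectrum.

(** The bound of [iterate_large] is the stronger one, because [gap < 2 * G], where
    [G] is the distance from the shift to the second eigenvalue, and [1 <= beta].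
    Dividing the exact value [sqrt (1 - xi ^ 2)] of [enorm (shifted A u *m w)] by
    the bound on [enorm w] gives the estimate of the new residual. *)
Lemma minres_step_estimates (R : realType) (n m : nat) (A X : 'M[R[i]]_n.+2)
    (lam : 'I_n.+2 -> R) (lambda xibar : R) (x u w : 'cV[R[i]]_n.+2) :
  standing A lambda x u lam X -> enorm u = 1 -> minres_iterate m A u w ->
  let xi := inner_residual A u w in
  let r := enorm (residual A u) in
  let gap := `|lam2 lam - lam1 lam| in
  xi <= xibar -> xibar < 1 -> sin_angle x u ^+ 2 <= (1 - xibar) / 6 ->
  (1 - xi) * gap / (4 * beta lam * r ^+ 2) <= enorm w /\
  enorm (residual A (normalized w)) <=
    Num.sqrt ((1 + xi) / (1 - xi)) * (4 * beta lam / gap) * r ^+ 2.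
Proof.
move=> [eigX _ colx ord] u1 mw xi r gap xi_le xibar_lt1 small.
have [far G2 gap0] := ordered_around_gap ord.
set G := `|lam2 lam - rayleigh A u| in far G2.
have G0 : 0 < G by rewrite -/gap in G2 gap0; lra.
have xi1 : xi < 1 by apply: le_lt_trans xibar_lt1.
have xi0 : 0 <= xi := enorm_ge0 _.
rewrite -colx in small.
have w0 := iterate_gt0 eigX u1 xi_le xibar_lt1 small.
have large := iterate_large eigX u1 xi_le xibar_lt1 small G0 far.
have b1 := beta_ge1 gap0; rewrite -/gap -/xi -/r in G2 gap0 large.
have W0 : 0 < r ^+ 2 * enorm w.
  have : 0 < (1 - xi) * G by rewrite mulr_gt0// subr_gt0.
  lra.
have r0 : 0 < r ^+ 2 by rewrite -(pmulr_lgt0 _ w0).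
have key : (1 - xi) * gap <= 4 * beta lam * r ^+ 2 * enorm w.
  have xi1' : 0 <= 1 - xi by lra.
  have := ler_wpM2l xi1' (ltW G2); have := ler_wpM2r (ltW W0) b1; lra.
have b0 : 0 < beta lam by lra.
have N0 : 0 < 4 * beta lam * r ^+ 2 by rewrite mulr_gt0// mulr_gt0.
split; first by rewrite ler_pdivrMr// [leRHS]mulrC.
set S := Num.sqrt _.
have SE : enorm (shifted A u *m w) = S * (1 - xi).
  apply/eqP; rewrite -(eqrXn2 (_ : 0 < 2)%N) ?mulr_ge0 ?sqrtr_ge0 ?subr_ge0 ?ltW//.
  have S0 : 0 <= (1 + xi) / (1 - xi) by apply: divr_ge0; lra.
  rewrite (minres_energy u1 mw) -/xi exprMn [S ^+ 2]sqr_sqrtr//.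
  have alg (a : R) : 1 - a != 0 -> 1 - a ^+ 2 = (1 + a) / (1 - a) * (1 - a) ^+ 2.
    by move=> ?; field.
  by apply/eqP/alg; rewrite gt_eqF// subr_gt0.
rewrite -(ler_pM2r w0); apply: le_trans (residual_normalized eigX u w0) _.
have -> : S * (4 * beta lam / gap) * r ^+ 2 * enorm w
   = S * ((4 * beta lam * r ^+ 2 * enorm w) / gap) by ring.
rewrite SE ler_wpM2l ?sqrtr_ge0//.
by rewrite ler_pdivlMr.
Qed.

Theorem theorem7 (R : realType) (n : nat) (A : 'M[R[i]]_n.+2)
    (lambda : R) (x : 'cV[R[i]]_n.+2) (xibar : R)
    (A_hermitian : A \is hermsymmx)
    (x_unit : enorm x = 1)
    (x_eigenvector : A *m x = lambda%:C *: x)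
    (xibar_lt1 : xibar < 1) :
  exists delta : R, 0 < delta /\
    (forall (lam : 'I_n.+2 -> R) (X : 'M[R[i]]_n.+2) (m : nat)
            (u w : 'cV[R[i]]_n.+2),
       enorm u = 1 -> sin_angle x u < delta ->
       standing A lambda x u lam X ->
       (1 < m)%N -> minres_iterate m A u w ->
       let xi := inner_residual A u w in
       let r := enorm (residual A u) in
       let gap := `|lam2 lam - lam1 lam| in
       xi <= xibar ->
       (1 - xi) * gap / (4 * beta lam * r ^+ 2) <= enorm w /\
       enorm (residual A (normalized w)) <=
         Num.sqrt ((1 + xi) / (1 - xi)) * (4 * beta lam / gap) * r ^+ 2) /\
    (forall (lam : 'I_n.+2 -> R) (X : 'M[R[i]]_n.+2) (m : nat -> nat)
            (u w : nat -> 'cV[R[i]]_n.+2),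
       sin_angle x (u 0%N) < delta ->
       standing A lambda x (u 0%N) lam X ->
       irqi_minres A xibar m u w ->
       converges_quadratically_to_0 (fun k => enorm (residual A (u k))) /\
       converges_quadratically_to_0 (fun k => sin_angle x (u k))).
Proof.
set d0 := Num.min 1 ((1 - xibar) / 6).
have d00 : 0 < d0 by rewrite lt_min ltr01 divr_gt0 ?subr_gt0.
have [d01 d0xi] : d0 <= 1 /\ d0 <= (1 - xibar) / 6.
  by rewrite /d0 !ge_min !lexx orbT.
(* The radius [delta] must precede the eigensystem, but it depends on the separation of
   [lambda]. One eigensystem satisfying the assumptions suffices to measure it;
   if there is none, nothing is to be proved. *)
have [[lam0 [X0 [v st]]]|none] := pselect (exists lam0 X0 v,
    standing A lambda x v lam0 X0); last first.
  exists d0; split=> //; split => [lam X m u w u1 sd st _ mw xi r gap xi_le|lam X m u w _ st].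
    have small := sqr_sin_angle_small d01 d0xi sd.
    exact: (minres_step_estimates st u1 mw xi_le xibar_lt1 small).
  by case: none; exists lam, X, (u 0%N).
have [g g0 hg] := standing_separation st.
have [eigX _ colx _] := st.
set D := \sum_i `|lam0 i - lam0 ord0|.
have D0 : 0 <= D by exact: sumr_ge0.
have D1 : 0 < D + 1 by lra.
set kappa := 5 / 6 * (1 - xibar) * (g / 2).
have kappa0 : 0 < kappa by rewrite !mulr_gt0 ?invr_gt0// subr_gt0.
set delta := Num.min d0 (Num.min (g / 2) (kappa / 2) / (D + 1)).
(* [D + 1] avoids dividing by [D], which could be zero. *)
have Dd (b : R) : Num.min (g / 2) (kappa / 2) <= b -> D * delta <= b.
  have m0 : 0 <= Num.min (g / 2) (kappa / 2) by rewrite le_min !divr_ge0// ltW.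
  apply: le_trans; apply: (@le_trans _ _ (D * (Num.min (g / 2) (kappa / 2) / (D + 1)))).
    by rewrite ler_wpM2l// ge_min lexx orbT.
  rewrite mulrCA -[leRHS]mulr1 ler_wpM2l// ler_pdivrMr// mul1r; lra.
have ddd : delta <= d0 by rewrite ge_min lexx.
exists delta; split; first by rewrite lt_min d00 divr_gt0// lt_min !divr_gt0.
have delta1 := le_trans ddd d01; have delta_xi := le_trans ddd d0xi.
split => [lam X m u w u1 sd st' _ mw xi r gap xi_le|_ _ m u w start _ it].
  have small := sqr_sin_angle_small delta1 delta_xi sd.
  exact: (minres_step_estimates st' u1 mw xi_le xibar_lt1 small).
rewrite -colx in start *.
have delta_g : D * delta <= g / 2 by apply: Dd; rewrite ge_min lexx.
have delta_k : D * delta <= kappa / 2 by apply: Dd; rewrite ge_min lexx orbT.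
have rq := irqi_residual_quadratic eigX xibar_lt1 g0 hg delta1 delta_xi delta_g delta_k it start.
have sq := irqi_sin_quadratic eigX xibar_lt1 g0 hg delta1 delta_xi delta_g delta_k it start.
by split.
Qed.
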